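(* Every specialization semilattice can be embedded into a topological specialization semilattice. That is, for every specialization semilattice $\mathbf S$ there are a topological space $X$ and an embedding of specialization semilattices from $\mathbf S$ to $\mathbf S(X) = (\mathcal P(X), \cup, \sqsubseteq)$.
   Context: Semilattices are join-semilattices: sets with a commutative, associative, idempotent operation $\vee$; the induced order is $a \leq b$ iff $a \vee b = b$. A specialization semilattice is a triple $(S, \vee, \sqsubseteq)$ such that $(S, \vee)$ is a semilattice and $\sqsubseteq$ is a binary relation on $S$ satisfying, for all $a, b, c, a_1 \in S$: (S1) $a \leq b$ implies $a \sqsubseteq b$; (S2) $a \sqsubseteq b$ and $b \sqsubseteq c$ imply $a \sqsubseteq c$; (S3) $a \sqsubseteq b$ and $a_1 \sqsubseteq b$ imply $a \vee a_1 \sqsubseteq b$. For a topological space $X$ with topological closure $K$, $\mathbf S(X) = (\mathcal P(X), \cup, \sqsubseteq)$ where, for $a,b \subseteq X$, $a \sqsubseteq b$ means $a \subseteq Kb$. A specialization semilattice is topological if it is isomorphic to $\mathbf S(X)$ for some topological space $X$. An embedding of specialization semilattices is an injective function $\psi$ with $\psi(a \vee b) = \psi(a) \vee \psi(b)$ and such that $a \sqsubseteq b$ if and only if $\psi(a) \sqsubseteq \psi(b)$, for all $a,b$. *)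

(* Defs.v *)
From HB Require Import structures.
From mathcomp Require Import all_boot all_order.
From mathcomp Require Import boolp classical_sets topology.

Set Implicit Arguments.
Unset Strict Implicit.
Unset Printing Implicit Defensive.

Import Order.TTheory.
Local Open Scope classical_set_scope.
Local Open Scope order_scope.

(* The specialization relation is Prop-valued and unrelated to the boolean
   order except through [spec_le]. *)
HB.mixin Record JoinSemilattice_isSpecialization d T
    of Order.JoinSemilattice d T := {
  spec : T -> T -> Prop ;
  spec_le : forall a b : T, a <= b -> spec a b ;
  spec_trans : forall a b c : T, spec a b -> spec b c -> spec a c ;
  spec_join : forall a a1 b : T,
    spec a b -> spec a1 b -> spec (Order.join a a1) b
}.

#[short(type="specSemilatticeType")]
HB.structure Definition SpecSemilattice d :=
  { T of Order.JoinSemilattice d T & JoinSemilattice_isSpecialization d T }.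

(* S(X): the order and the join that [set X] already carries in the library
   are inclusion and union (see [subsetEset] and [joinEset]). *)
Section TopologicalSpecialization.
Variable X : topologicalType.

Definition closure_spec (a b : set X) : Prop := (a `<=` closure b)%classic.

Lemma closure_spec_le (a b : set X) : a <= b -> closure_spec a b.
Proof.
by rewrite subsetEset => ab; apply: subset_trans ab _; exact: subset_closure.
Qed.

Lemma closure_spec_trans (a b c : set X) :
  closure_spec a b -> closure_spec b c -> closure_spec a c.
Proof.
move=> ab bc; apply: subset_trans ab _.
apply: subset_trans (closureS bc) _; exact: closed_closure.
Qed.

Lemma closure_spec_join (a a1 b : set X) :
  closure_spec a b -> closure_spec a1 b -> closure_spec (Order.join a a1) b.
Proof. by move=> ab a1b x [/ab|/a1b]. Qed.

HB.instance Definition _ :=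
  JoinSemilattice_isSpecialization.Build _ (set X)
    closure_spec_le closure_spec_trans closure_spec_join.

End TopologicalSpecialization.

Definition spec_embedding d (S : specSemilatticeType d)
    d' (T : specSemilatticeType d') (psi : S -> T) : Prop :=
  [/\ injective psi,
      {morph psi : a b / Order.join a b} &
      forall a b : S, spec a b <-> spec (psi a) (psi b)].

(* Main.v *)
Require Import Defs.
From HB Require Import structures.
From mathcomp Require Import all_boot all_order.
From mathcomp Require Import boolp classical_sets topology.

(** Every map sending [a] to the set of those ideals of [S] that miss [a] turns
    joins into unions, because an ideal contains a join exactly when it contains
    both terms.  Three kinds of ideals are taken as points: the order ideals
    [{y | y <= x}], the specialization ideals [{y | y ⊑ x}], and the empty ideal.
    The order ideals separate the elements of [S], so the map is injective
    ([miss_inj]).  The specialization ideals detect [⊑]: when [a ⊑ b] fails, the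
    one generated by [b] misses [a] and contains [b].

    It remains to choose a topology in which the order ideals, which are not
    closed downwards for [⊑], never prevent [miss a] from lying in the closure
    of [miss b].  The empty ideal misses every element, hence lies in every
    [miss b]; so it suffices that its closure consist of itself and all order
    ideals, while the other points are closed ([closure_idealE]).  Then [miss a] lies
    in the closure of [miss b] exactly when every ideal that is empty or a
    specialization ideal and misses [a] also misses [b], that is, when
    [a ⊑ b]. *)

Set Implicit Arguments.
Unset Strict Implicit.
Unset Printing Implicit Defensive.

Import Order.TTheory.
Local Open Scope classical_set_scope.
Local Open Scope order_scope.

(** Names for ideals rather than ideals as sets: an order ideal and a
    specialization ideal that have the same elements must stay distinct points,
    since the topology treats them differently. *)
Inductive ideal_point (T : Type) : Type :=
  | OrderIdeal of T
  | SpecIdeal of T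
  | EmptyIdeal.
Arguments EmptyIdeal {T}.

HB.instance Definition _ (T : Type) := gen_eqMixin (ideal_point T).
HB.instance Definition _ (T : Type) := gen_choiceMixin (ideal_point T).

Definition ideal_open (T : Type) (U : set (ideal_point T)) : Prop :=
  forall x, U (OrderIdeal x) -> U EmptyIdeal.

Lemma ideal_openT (T : Type) : ideal_open [set: ideal_point T].
Proof. by []. Qed.

Lemma ideal_openI (T : Type) (U V : set (ideal_point T)) :
  ideal_open U -> ideal_open V -> ideal_open (U `&` V).
Proof. by move=> oU oV x [/oU ? /oV ?]. Qed.

Lemma ideal_open_bigcup (T I : Type) (f : I -> set (ideal_point T)) :
  (forall i, ideal_open (f i)) -> ideal_open (\bigcup_i f i).
Proof. by move=> of_ x [i _ /of_ ?]; exists i. Qed.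

HB.instance Definition _ (T : Type) :=
  isOpenTopological.Build (ideal_point T)
    (@ideal_openT T) (@ideal_openI T) (@ideal_open_bigcup T).

Lemma closure_idealE (T : Type) (A : set (ideal_point T)) :
  closure A = A `|` [set p | A EmptyIdeal /\ exists x, p = OrderIdeal x].
Proof.
apply/seteqP; split=> [p clAp | p [Ap | [A0 [x ->]]]].
- (* The smallest open set around an order ideal adds the empty ideal; every
     other point is isolated. *)
  pose U := [set q | q = p \/ q = EmptyIdeal /\ exists x, p = OrderIdeal x].
  have oU : open U by move=> x [xp | [] //]; right; split=> //; exists x.
  have Up : nbhs p U by apply: open_nbhs_nbhs; split=> //; left.
  have [q [Aq [<- | [q0 px]]]] := clAp U Up; first by left.
  by right; split=> //; rewrite -q0.
- exact: subset_closure.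
- move=> B; rewrite nbhsE => -[V [oV Vx] VB].
  by exists EmptyIdeal; split=> //; apply: VB; exact: oV Vx.
Qed.

Definition in_ideal d (S : specSemilatticeType d) (p : ideal_point S) (a : S) :
    Prop :=
  match p with
  | OrderIdeal x => a <= x
  | SpecIdeal x => spec a x
  | EmptyIdeal => False
  end.

Lemma in_ideal_join d (S : specSemilatticeType d) (p : ideal_point S) (a b : S) :
  in_ideal p (Order.join a b) <-> in_ideal p a /\ in_ideal p b.
Proof.
case: p => [x | x |] /=; last by split=> [|[]].
- by rewrite leUx; split=> /andP.
- split=> [abx | [ax bx]]; last exact: spec_join.
  by split; apply: spec_trans abx; apply: spec_le; rewrite ?leUl ?leUr.
Qed.

Definition miss d (S : specSemilatticeType d) (a : S) : set (ideal_point S) :=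
  [set p | ~ in_ideal p a].

Lemma miss_inj d (S : specSemilatticeType d) : injective (@miss d S).
Proof.
have le_of_miss (a b : S) : miss a = miss b -> a <= b.
  move=> ab; apply: contrapT => nab.
  have : miss b (OrderIdeal b) by rewrite -ab.
  by apply; exact: lexx.
by move=> a b ab; apply: le_anti; rewrite !le_of_miss.
Qed.

Lemma miss_join d (S : specSemilatticeType d) (a b : S) :
  miss (Order.join a b) = miss a `|` miss b.
Proof.
by apply/funext => p; apply/propext; rewrite /miss /= in_ideal_join not_andP.
Qed.

Lemma spec_miss d (S : specSemilatticeType d) (a b : S) :
  spec a b <-> miss a `<=` closure (miss b).
Proof.
rewrite closure_idealE; split=> [ab p | ab].
- case: p => [x _ | x nax | _]; last by left.
  + by right; split=> [|]; [case | exists x].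
  + by left=> bx; apply: nax; exact: spec_trans ab bx.
- apply: contrapT => nab.
  have [nbb | [_ [x //]]] := ab (SpecIdeal b) nab.
  by apply: nbb; apply: spec_le.
Qed.

Theorem theorem5p7 (d : Order.disp_t) (S : specSemilatticeType d) :
  exists (X : topologicalType) (psi : S -> set X), spec_embedding psi.
Proof.
exists (ideal_point S), (@miss d S); split.
- exact: miss_inj.
- by move=> a b; rewrite joinEset; exact: miss_join.
- exact: spec_miss.
Qed.
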